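(* Let $X'\subset X$ and $g\in\mathcal{G}$. Consider the following statements: (1) Problem $(\mathcal{P}')$ has a solution; (2) $X'\subset\mathrm{dom}(\partial^\circ g)$; (3) $\{(\partial^\circ g)^{-1}(y)\}_{y\in Y}$ is a covering of $X'$; (4) $\{(\partial^\circ g)^{-1}(y)\}_{y\in\mathrm{ldom}(B^\circ g)}$ is a covering of $X'\cap\mathrm{udom}(g)$; (5) $\{(\partial^\circ g)^{-1}(y)\}_{y\in\mathrm{dom}(B^\circ g)}$ is a covering of $X'\cap\mathrm{dom}(g)$. Then: (a) (2)$\Leftrightarrow$(3)$\Leftrightarrow$(4), and (4) implies both (1) and (5). (b) The implication (1)$\Rightarrow$(4) holds if [(A5) or (A5$'$)] and [(A6) or (A6$'$)] hold, where (A5): $Y$ is discrete; (A5$'$): $b$ is continuous in the second variable, and $B^\circ g(y)>-\infty$ for all $y\in Y$; (A6): $B^\circ g\in\mathcal{F}_c$; (A6$'$): $b$ is coercive and $X'\subset\mathrm{idom}(g)\cup g^{-1}(-\infty)$. This is the case in particular if $Y$ is finite. (c) The implication (5)$\Rightarrow$(4) holds when $X'\subset\mathrm{idom}(g)\cup g^{-1}(-\infty)$. (d) Statements (1)--(5) are all true when $g\equiv+\infty$ or $g\equiv-\infty$.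
   Context: Setting. $\overline{\mathbb{R}}=\mathbb{R}\cup\{\pm\infty\}$ with its usual order and topology. $X,Y$ are nonempty Hausdorff topological spaces, $\mathcal{F}=\mathrm{lsc}(Y,\overline{\mathbb{R}})$ is the set of lower semicontinuous functions $Y\to\overline{\mathbb{R}}$, $\mathcal{G}=\overline{\mathbb{R}}^X$ is the set of all functions $X\to\overline{\mathbb{R}}$, both with the pointwise order. $(B,B^\circ)$, $B:\mathcal{F}\to\mathcal{G}$, $B^\circ:\mathcal{G}\to\mathcal{F}$, is a dual Galois connection: $g\geq Bf\iff f\geq B^\circ g$ for all $f\in\mathcal{F},g\in\mathcal{G}$. Its kernels are the (unique) maps $b:X\times Y\times\overline{\mathbb{R}}\to\overline{\mathbb{R}}$, $b^\circ:Y\times X\times\overline{\mathbb{R}}\to\overline{\mathbb{R}}$ such that for all $(x,y)$, $(b(x,y,\cdot),b^\circ(y,x,\cdot))$ is a dual Galois connection between $\overline{\mathbb{R}}$ and $\overline{\mathbb{R}}$ (i.e. $t\geq b(x,y,s)\iff s\geq b^\circ(y,x,t)$), $b^\circ(\cdot,x,t)\in\mathcal{F}$ for all $x,t$, and $Bf(x)=\sup_{y\in Y}b(x,y,f(y))$, $B^\circ g(y)=\sup_{x\in X}b^\circ(y,x,g(x))$. Standing assumptions. There is a subset $\mathcal{S}\subset X\times Y$ such that: (A1) $\mathcal{S}_x=\{y\in Y\mid(x,y)\in\mathcal{S}\}\neq\emptyset$ for all $x\in X$; (A2) $\mathcal{S}^y=\{x\in X\mid(x,y)\in\mathcal{S}\}\neq\emptyset$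 for all $y\in Y$; (A3) $b(x,y,\cdot)$ is a bijection $\overline{\mathbb{R}}\to\overline{\mathbb{R}}$ for all $(x,y)\in\mathcal{S}$; (A4) $b(x,y,\cdot)\equiv-\infty$ for $(x,y)\in(X\times Y)\setminus\mathcal{S}$. Problem $(\mathcal{P}')$ (for given $g\in\mathcal{G}$, $X'\subset X$): find $f\in\mathcal{F}$ such that $Bf\leq g$ and $Bf(x)=g(x)$ for all $x\in X'$. Domains. For $h:Z\to\overline{\mathbb{R}}$, $Z$ a topological space: $\mathrm{ldom}(h)=\{z\mid h(z)<+\infty\}$, $\mathrm{udom}(h)=\{z\mid h(z)>-\infty\}$, $\mathrm{dom}(h)=\mathrm{ldom}(h)\cap\mathrm{udom}(h)$, $\mathrm{idom}(h)=\{z\in\mathrm{dom}(h)\mid\limsup_{z'\to z}h(z')<+\infty\}$. Subdifferential of $g\in\mathcal{G}$ at $x\in X$: $\partial^\circ g(x)=\{y\in Y\mid(x,y)\in\mathcal{S},\ b^\circ(y,x',g(x'))\leq b^\circ(y,x,g(x))\ \forall x'\in X\}$. For a map $F$ from a set $Z$ to the set of subsets of $W$: $F^{-1}(w)=\{z\in Z\mid w\in F(z)\}$, $\mathrm{dom}(F)=\{z\in Z\mid F(z)\neq\emptyset\}$; for $Z'\subset Z$, $W'\subset W$, $\{F(z)\}_{z\in Z'}$ is a covering of $W'$ if $\bigcup_{z\in Z'}F(z)\supset W'$. $b$ is continuous in the second variable if $b(x,\cdot,\alpha)$ is continuous for all $x\in X$, $\alpha\in\mathbb{R}$. $b$ is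 coercive if for all $x\in X$, all neighbourhoods $V$ of $x$ in $X$ and all $\alpha\in\mathbb{R}$, the function $b^\alpha_{x,V}(y)=\sup_{z\in V}b(z,y,b^\circ(y,x,\alpha))$ is such that $\{y\in Y\mid b^\alpha_{x,V}(y)\leq\beta\}$ is relatively compact for all $\beta\in\mathbb{R}$. $\mathcal{F}_c$ is the set of $f\in\mathcal{F}$ such that for all $x\in X$ and $\beta\in\mathbb{R}$, $\{y\in Y\mid b(x,y,f(y))\geq\beta\}$ is relatively compact. *)

(* Defs.v *)
From mathcomp Require Import all_boot all_order all_algebra.
From mathcomp Require Import all_classical all_reals all_analysis.

Set Implicit Arguments.
Unset Strict Implicit.
Unset Printing Implicit Defensive.

Import Order.TTheory GRing.Theory Num.Theory.
Import numFieldNormedType.Exports.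

Local Open Scope classical_set_scope.
Local Open Scope ring_scope.
Local Open Scope ereal_scope.

Record lsc (Y : topologicalType) (R : realType) := Lsc {
  lsc_fun :> Y -> \bar R;
  lscP : lower_semicontinuous lsc_fun }.

Definition pointwise_le (Z : Type) (R : realType) (h k : Z -> \bar R) : Prop :=
  forall z, h z <= k z.

Definition dual_galois (P Q : Type) (leP : P -> P -> Prop)
    (leQ : Q -> Q -> Prop) (u : P -> Q) (v : Q -> P) : Prop :=
  forall p q, leQ (u p) q <-> leP (v q) p.

Definition dual_galois_fun (X Y : topologicalType) (R : realType)
    (B : lsc Y R -> (X -> \bar R)) (Bo : (X -> \bar R) -> lsc Y R) : Prop :=
  dual_galois (fun f1 f2 : lsc Y R => pointwise_le f1 f2)
    (@pointwise_le X R) B Bo.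

Definition dual_galois_ereal (R : realType) (u v : \bar R -> \bar R) : Prop :=
  dual_galois (fun s1 s2 : \bar R => s1 <= s2)
    (fun t1 t2 : \bar R => t1 <= t2) u v.

Record galois_kernels (X Y : topologicalType) (R : realType)
    (B : lsc Y R -> (X -> \bar R)) (Bo : (X -> \bar R) -> lsc Y R)
    (b : X -> Y -> \bar R -> \bar R) (bo : Y -> X -> \bar R -> \bar R) : Prop :=
  GaloisKernels {
    kernels_galois : forall x y, dual_galois_ereal (b x y) (bo y x);
    kernels_lsc : forall x t, lower_semicontinuous (fun y => bo y x t);
    kernels_supB : forall f x, B f x = ereal_sup [set b x y (f y) | y in [set: Y]];
    kernels_supBo : forall g y, Bo g y = ereal_sup [set bo y x (g x) | x in [set: X]]
  }.

Record kernel_support (X Y : topologicalType) (R : realType)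
    (b : X -> Y -> \bar R -> \bar R) (S : set (X * Y)) : Prop :=
  KernelSupport {
    support_x : forall x, [set y | S (x, y)] !=set0;
    support_y : forall y, [set x | S (x, y)] !=set0;
    support_bij : forall x y, S (x, y) -> bijective (b x y);
    support_out : forall x y, ~ S (x, y) -> forall s, b x y s = -oo
  }.

Definition problem (X Y : topologicalType) (R : realType)
    (B : lsc Y R -> (X -> \bar R)) (X' : set X) (g : X -> \bar R) : Prop :=
  exists f : lsc Y R,
    pointwise_le (B f) g /\ forall x, X' x -> B f x = g x.

Definition ldom (Z : Type) (R : realType) (h : Z -> \bar R) : set Z :=
  [set z | h z < +oo].

Definition udom (Z : Type) (R : realType) (h : Z -> \bar R) : set Z :=
  [set z | -oo < h z].

Definition fdom (Z : Type) (R : realType) (h : Z -> \bar R) : set Z :=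
  ldom h `&` udom h.

(* The limsup is over full neighbourhoods of z; since h z < +oo on fdom h,
   deleting the point z would give the same set. *)
Definition idom (Z : topologicalType) (R : realType) (h : Z -> \bar R) : set Z :=
  [set z | fdom h z /\ limf_esup h (nbhs z) < +oo].

Definition subdiff (X Y : topologicalType) (R : realType)
    (bo : Y -> X -> \bar R -> \bar R) (S : set (X * Y)) (g : X -> \bar R) :
    X -> set Y :=
  fun x => [set y | S (x, y) /\ forall x', bo y x' (g x') <= bo y x (g x)].

Definition mapinv (Z W : Type) (F : Z -> set W) : W -> set Z :=
  fun w => [set z | F z w].

Definition mapdom (Z W : Type) (F : Z -> set W) : set Z :=
  [set z | F z !=set0].

Definition covering (Z W : Type) (Z' : set Z) (F : Z -> set W) (W' : set W) :
    Prop :=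
  W' `<=` cover Z' F.

Definition discrete (Y : topologicalType) : Prop := forall A : set Y, open A.

Definition continuous_second (X Y : topologicalType) (R : realType)
    (b : X -> Y -> \bar R -> \bar R) : Prop :=
  forall x (a : R), continuous (fun y => b x y a%:E).

Definition coercive (X Y : topologicalType) (R : realType)
    (b : X -> Y -> \bar R -> \bar R) (bo : Y -> X -> \bar R -> \bar R) : Prop :=
  forall (x : X) (V : set X) (a : R), nbhs x V ->
  forall c : R,
    precompact [set y | ereal_sup [set b z y (bo y x a%:E) | z in V] <= c%:E].

Definition Fc (X Y : topologicalType) (R : realType)
    (b : X -> Y -> \bar R -> \bar R) : set (lsc Y R) :=
  [set f | forall (x : X) (c : R), precompact [set y | c%:E <= b x y (f y)]].

(* Main.v *)
(* Everything reduces to f = B^o g: it is the least candidate, B B^o g <= g always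
   holds, and (P') has a solution iff B B^o g = g on X'. On S the kernels
   b(x,y,.) and b^o(y,x,.) are mutually inverse decreasing bijections, so, when
   g(x) > -oo, y is a subgradient at x iff the supremum
   B B^o g(x) = sup_y b(x, y, B^o g(y)) = g(x) is attained at y. For (1) => (4),
   attainment comes from y |-> b(x, y, B^o g(y)) being upper semicontinuous
   ((A5) or (A5')) with relatively compact superlevel sets ((A6) or (A6')). *)
Require Import Defs.
From mathcomp Require Import all_boot all_order all_algebra.
From mathcomp Require Import all_classical all_reals all_analysis.

Import Order.TTheory GRing.Theory Num.Theory.
Import numFieldNormedType.Exports.

Local Open Scope classical_set_scope.
Local Open Scope ring_scope.
Local Open Scope ereal_scope.

Set Implicit Arguments.
Unset Strict Implicit.

(** * Attainment of suprema of upper semicontinuous functions *)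

Lemma lte_real_between (R : realType) (x y : \bar R) :
  x < y -> exists r : R, x < r%:E /\ r%:E < y.
Proof.
case: x y => [x||] [y||]//.
- rewrite lte_fin => xy; exists ((x + y) / 2)%R.
  by rewrite !lte_fin midf_lt// midf_lt.
- by move=> _; exists (x + 1)%R; rewrite lte_fin ltrDl ltr01 ltry.
- by move=> _; exists (y - 1)%R; rewrite lte_fin ltrBlDr ltrDl ltr01 ltNyr.
- by move=> _; exists 0%R; rewrite ltry ltNyr.
Qed.

(* [compact_cover] needs a pointed space, hence the argument through the filter
   generated by the superlevel sets. *)
Lemma compact_usc_max (R : realType) (Y : topologicalType) (h : Y -> \bar R)
    (K : set Y) :
  compact K -> K !=set0 -> (forall t, open [set y | h y < t]) ->
  exists2 y, K y & forall z, K z -> h z <= h y.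
Proof.
move=> cK [y0 Ky0] usch; apply: contrapT => nomax.
pose F := filter_from K (fun y => K `&` [set z | h y <= h z]).
have FF : ProperFilter F.
  apply: filter_from_proper; last by move=> y Ky; exists y; split=> /=.
  apply: filter_from_filter; first by exists y0.
  move=> y z Ky Kz; have [yz|/ltW zy] := leP (h y) (h z).
    exists z => // w [Kw zw]; do 2!split=> //=; exact: le_trans zw.
  exists y => // w [Kw yw]; do 2!split=> //=; exact: le_trans yw.
have FK : F K by exists y0 => // z [].
have [p [Kp clFp]] := cK F FF FK.
(* If [h p < h y], the open set where [h] stays below [h y] is a neighbourhood of the cluster point
   [p] that misses a member of [F]. *)
apply: nomax; exists p => // y Ky; rewrite leNgt; apply/negP => hpy.
have Fy : F [set z | h y <= h z] by exists y => // z [].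
have [z [/= yz]] := clFp _ _ Fy (open_nbhs_nbhs (conj (usch (h y)) hpy)).
by rewrite ltNge yz.
Qed.

(** A real [c] below the supremum gives a nonempty superlevel set with compact closure. A maximum
    over this closure is global, because elsewhere [h] is below [c]. *)
Lemma precompact_usc_sup_attained (R : realType) (Y : topologicalType)
    (h : Y -> \bar R) :
  (forall c : R, precompact [set y | c%:E <= h y]) ->
  (forall t, open [set y | h y < t]) ->
  -oo < ereal_sup (h @` [set: Y]) ->
  exists y, h y = ereal_sup (h @` [set: Y]).
Proof.
move=> cpt usch /lte_real_between[c [_ /ereal_sup_gt[_ [y1 _ <-] cy1]]].
have := cpt c; rewrite precompactE => cK.
have Ky1 : closure [set y | c%:E <= h y] y1 by apply/subset_closure/ltW.
have [y _ ymax] := compact_usc_max cK (ex_intro _ _ Ky1) usch.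
exists y; apply/eqP; rewrite eq_le; apply/andP; split.
  by apply: ereal_sup_ubound; exists y.
apply: ge_ereal_sup => _ [z _ <-].
have [cz|zc] := leP c%:E (h z); first exact/ymax/subset_closure.
exact: le_trans (ltW zc) (le_trans (ltW cy1) (ymax _ Ky1)).
Qed.

(** * Dual Galois connections on the extended reals *)

Section dual_galois_ereal_theory.
Context (R : realType) (u v : \bar R -> \bar R).
Hypothesis uv : dual_galois_ereal u v.

Lemma dual_galois_ereal_sym : dual_galois_ereal v u.
Proof. by move=> s t; split=> /uv. Qed.

Lemma dual_galois_ereal_anti s t : s <= t -> u t <= u s.
Proof. by move=> st; apply/uv; apply: le_trans st; apply/uv. Qed.

Lemma dual_galois_ereal_pinfty : u +oo = -oo.
Proof. by apply/eqP; rewrite -leeNy_eq; apply/uv; exact: leey. Qed.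

End dual_galois_ereal_theory.

Section dual_galois_ereal_bij.
Context (R : realType) (u v : \bar R -> \bar R).
Hypotheses (uv : dual_galois_ereal u v) (bij_u : bijective u).

(** Every dual Galois connection satisfies [u (v (u s)) = u s]; injectivity of [u] cancels the outer
    [u]. *)
Lemma dual_galois_ereal_bijK : cancel u v.
Proof.
move=> s; apply: (bij_inj bij_u); apply/eqP; rewrite eq_le.
apply/andP; split; first exact/uv.
by apply: (dual_galois_ereal_anti uv); apply/uv.
Qed.

Lemma dual_galois_ereal_bijVK : cancel v u.
Proof.
by move=> t; case: bij_u => w _ uw; rewrite -[t]uw dual_galois_ereal_bijK.
Qed.

Lemma dual_galois_ereal_bij_ninfty : v -oo = +oo.
Proof.
by rewrite -(dual_galois_ereal_pinfty uv) dual_galois_ereal_bijK.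
Qed.

End dual_galois_ereal_bij.

(** * Kernels, subgradients and the candidate [Bo g] *)

Section kernels.
Context (R : realType) (X Y : topologicalType).
Context (B : lsc Y R -> (X -> \bar R)) (Bo : (X -> \bar R) -> lsc Y R).
Context (b : X -> Y -> \bar R -> \bar R) (bo : Y -> X -> \bar R -> \bar R).
Context (S : set (X * Y)).
Hypotheses (BBo : dual_galois_fun B Bo) (bbo : galois_kernels B Bo b bo).
Hypothesis bS : kernel_support b S.
Implicit Types (x : X) (y : Y) (s t : \bar R) (g : X -> \bar R).

Let galois_b x y : dual_galois_ereal (b x y) (bo y x).
Proof. exact: kernels_galois bbo x y. Qed.

Let le_b x y s t : (b x y s <= t) = (bo y x t <= s).
Proof. by apply/idP/idP => /galois_b. Qed.

Let bij_b x y : S (x, y) -> bijective (b x y).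
Proof. exact: support_bij bS x y. Qed.

Let bK x y : S (x, y) -> cancel (b x y) (bo y x).
Proof. by move=> /bij_b; exact: dual_galois_ereal_bijK. Qed.

Let boK x y : S (x, y) -> cancel (bo y x) (b x y).
Proof. by move=> /bij_b; exact: dual_galois_ereal_bijVK. Qed.

Let bo_anti x y s t : s <= t -> bo y x t <= bo y x s.
Proof.
exact: (dual_galois_ereal_anti (dual_galois_ereal_sym (galois_b x y))).
Qed.

Lemma kernel_support_gtNy x y s : -oo < b x y s -> S (x, y).
Proof.
move=> bs; apply: contrapT => /(support_out bS) bN.
by rewrite bN ltxx in bs.
Qed.

(** The subgradient inequality says that the supremum defining [Bo g y] is attained at [x]. *)
Lemma subdiff_Bo g x y : subdiff bo S g x y -> Bo g y = bo y x (g x).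
Proof.
move=> [_ gmax]; rewrite (kernels_supBo bbo); apply/eqP; rewrite eq_le.
apply/andP; split; first by apply: ge_ereal_sup => _ [z _ <-].
by apply: ereal_sup_ubound; exists x.
Qed.

(** Since [g x] is not [-oo], the pair lies in [S]; inverting [b x y] gives [bo y x (g x) = Bo g y],
    which bounds every [bo y x' (g x')]. *)
Lemma kernel_eq_subdiff g x y :
  -oo < g x -> b x y (Bo g y) = g x -> subdiff bo S g x y.
Proof.
move=> gx bgx; have Sxy : S (x, y).
  by apply: (@kernel_support_gtNy _ _ (Bo g y)); rewrite bgx.
split=> // x'; rewrite -bgx bK//.
by rewrite (kernels_supBo bbo); apply: ereal_sup_ubound; exists x'.
Qed.

Lemma BBo_le g : pointwise_le (B (Bo g)) g.
Proof. by apply/BBo => y; exact: lexx. Qed.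

Lemma problem_Bo (X' : set X) g :
  problem B X' g -> forall x, X' x -> B (Bo g) x = g x.
Proof.
move=> [f [Bfg Bf]] x X'x; apply/eqP; rewrite eq_le BBo_le/= -(Bf _ X'x).
have Bogf : pointwise_le (Bo g) f by exact/BBo.
(* [B] reverses the order; this follows from [Bo (B h) <= h] at [h = Bo g] and from [Bo g <= f]. *)
suff : pointwise_le (B f) (B (Bo g)) by exact.
by apply/BBo => y; apply: le_trans (Bogf y); move: y; apply/BBo.
Qed.

Lemma subdiff_problem g x y : subdiff bo S g x y -> B (Bo g) x = g x.
Proof.
move=> dgxy; apply/eqP; rewrite eq_le BBo_le/= (kernels_supB bbo).
apply: ereal_sup_ubound; exists y => //.
by rewrite (subdiff_Bo dgxy) boK//; case: dgxy.
Qed.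

(** If [bo y x t] were [+oo], applying [b x y] would give [t = -oo]. *)
Lemma bo_lty x y t : S (x, y) -> -oo < t -> bo y x t < +oo.
Proof.
move=> Sxy; rewrite !ltNge !leye_eq !leeNy_eq; apply: contra => /eqP bot.
by rewrite -(boK Sxy t) bot (dual_galois_ereal_pinfty (galois_b x y)).
Qed.

Lemma bo_gtNy x y t : S (x, y) -> t < +oo -> -oo < bo y x t.
Proof.
move=> Sxy; rewrite !ltNge !leye_eq !leeNy_eq; apply: contra => /eqP bot.
have boN : bijective (bo y x) by exists (b x y); [exact: boK|exact: bK].
rewrite -(boK Sxy t) bot; apply/eqP.
exact: dual_galois_ereal_bij_ninfty (dual_galois_ereal_sym (galois_b x y)) boN.
Qed.

(** A real [a] separates two conditions: near [y0], semicontinuity keeps [h] above [a] and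
    continuity keeps [b x y a%:E] below [t]. As [b x y] is decreasing, [b x y (h y) < t] there. *)
Lemma usc_kernel (h : lsc Y R) x :
  continuous_second b -> (forall y, -oo < h y) ->
  forall t, open [set y | b x y (h y) < t].
Proof.
move=> cb hNy t; rewrite openE => y0 /= ht.
have [a [bat ah]] : exists a : R, b x y0 a%:E < t /\ a%:E < h y0.
  have [Sxy|nSxy] := pselect (S (x, y0)); last first.
    have [a [_ ah]] := lte_real_between (hNy y0).
    by exists a; move: ht; rewrite !(support_out bS nSxy).
  (* On [S] the bound [b x y0 a%:E < t] amounts to [bo y0 x t < a%:E], so [a] is taken between
     [bo y0 x t] and [h y0]. *)
  have /lte_real_between[a [boa ah]] : bo y0 x t < h y0.
    rewrite ltNge; apply/negP => /(dual_galois_ereal_anti (galois_b x y0)).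
    by rewrite boK// leNgt ht.
  exists a; split=> //; rewrite ltNge; apply/negP => tba.
  by have := bo_anti x y0 tba; rewrite bK// leNgt boa.
have [V Vy0 hV] := lscP ah.
have Nb : nbhs y0 [set y | b x y a%:E < t].
  have Nt : nbhs (b x y0 a%:E) [set s | s < t].
    by apply: open_nbhs_nbhs; split; first exact: open_ereal_lt_ereal.
  exact: (cb x a y0 _ Nt).
apply: filterS (filterI Vy0 Nb) => y [/= /hV /ltW ahy].
by apply: le_lt_trans; exact: (dual_galois_ereal_anti (galois_b x y) ahy).
Qed.

Lemma coercive_precompact g x :
  coercive b bo -> idom g x ->
  forall c : R, precompact [set y | c%:E <= b x y (Bo g y)].
Proof.
move=> cob [_]; rewrite limf_esupE => /ereal_inf_lt[_ [V Vx <-]].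
move=> /lte_real_between[a [gVa _]] c.
(* If b(x,y,B^o g(y)) >= c then b^o(y,z,g(z)) <= B^o g(y) <= b^o(y,x,c), i.e.,
   b(z,y,b^o(y,x,c)) <= g(z) <= a for all z in V. *)
apply: precompact_subset (cob x V c Vx a) => y /= cb.
have Sxy : S (x, y).
  apply: (@kernel_support_gtNy _ _ (Bo g y)).
  exact: lt_le_trans (ltNyr c) cb.
have hc : Bo g y <= bo y x c%:E.
  by rewrite -[Bo g y](bK Sxy); exact: bo_anti.
apply: ge_ereal_sup => _ [z Vz <-].
apply: (@le_trans _ _ (g z)).
  rewrite le_b; apply: le_trans hc.
  by rewrite (kernels_supBo bbo); apply: ereal_sup_ubound; exists z.
by apply: le_trans (ltW gVa); apply: ereal_sup_ubound; exists z.
Qed.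

Lemma usc_precompact_subdiff g x :
  -oo < g x -> B (Bo g) x = g x ->
  (forall t, open [set y | b x y (Bo g y) < t]) ->
  (forall c : R, precompact [set y | c%:E <= b x y (Bo g y)]) ->
  exists y, subdiff bo S g x y.
Proof.
move=> gx; rewrite (kernels_supB bbo) => BBog usc cpt.
have [|y by_] := precompact_usc_sup_attained cpt usc; first by rewrite BBog.
by exists y; apply: kernel_eq_subdiff => //; rewrite by_.
Qed.

Lemma subdiff_ldom g x y : subdiff bo S g x y -> -oo < g x -> ldom (Bo g) y.
Proof.
by move=> dgxy gx; rewrite /ldom/= (subdiff_Bo dgxy) bo_lty//; case: dgxy.
Qed.

Lemma subdiff_udom g x y : subdiff bo S g x y -> g x < +oo -> udom (Bo g) y.
Proof.
by move=> dgxy gx; rewrite /udom/= (subdiff_Bo dgxy) bo_gtNy//; case: dgxy.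
Qed.

(** On [S], [bo y x -oo = +oo] is the largest possible value, so any [y] related to [x] works. *)
Lemma subdiff_ninfty g x : g x = -oo -> exists y, subdiff bo S g x y.
Proof.
move=> gx; have [y /= Sxy] := support_x bS x; exists y; split=> // x'.
rewrite gx (dual_galois_ereal_bij_ninfty (galois_b x y)) ?leey//.
exact: bij_b.
Qed.

Lemma subdiff_pinfty g x : (forall x', g x' = +oo) ->
  exists y, subdiff bo S g x y.
Proof.
move=> gpoo; have [y /= Sxy] := support_x bS x; exists y; split=> // x'.
have -> : bo y x' (g x') = -oo; last exact: leNye.
rewrite gpoo.
exact: dual_galois_ereal_pinfty (dual_galois_ereal_sym (galois_b x' y)).
Qed.

End kernels.

(** * Finite Hausdorff spaces *)

Lemma finite_hausdorff_discrete (Y : topologicalType) :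
  hausdorff_space Y -> finite_set [set: Y] -> discrete Y.
Proof.
move=> hY finY A.
have clY := accessible_finite_set_closed.1 (hausdorff_accessible hY).
rewrite -[A]setCK; apply: closed_openC; apply: clY.
exact: sub_finite_set finY.
Qed.

Lemma finite_hausdorff_precompact (Y : topologicalType) (A : set Y) :
  hausdorff_space Y -> finite_set [set: Y] -> precompact A.
Proof.
move=> hY finY; apply: compact_precompact hY _.
apply: finite_compact; exact: sub_finite_set finY.
Qed.

Unset Implicit Arguments.

Theorem theorem3p5 (R : realType) (X Y : topologicalType)
  (X_neq0 : [set: X] !=set0) (Y_neq0 : [set: Y] !=set0)
  (X_hausdorff : hausdorff_space X) (Y_hausdorff : hausdorff_space Y)
  (B : lsc Y R -> (X -> \bar R)) (Bo : (X -> \bar R) -> lsc Y R)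
  (B_galois : dual_galois_fun B Bo)
  (b : X -> Y -> \bar R -> \bar R) (bo : Y -> X -> \bar R -> \bar R)
  (b_kernels : galois_kernels B Bo b bo)
  (S : set (X * Y)) (S_support : kernel_support b S)
  (X' : set X) (g : X -> \bar R) :
  let dg := subdiff bo S g in
  let st1 := problem B X' g in
  let st2 := X' `<=` mapdom dg in
  let st3 := covering [set: Y] (mapinv dg) X' in
  let st4 := covering (ldom (Bo g)) (mapinv dg) (X' `&` udom g) in
  let st5 := covering (fdom (Bo g)) (mapinv dg) (X' `&` fdom g) in
  let A5 := discrete Y in
  let A5' := continuous_second b /\ (forall y, -oo < Bo g y) in
  let A6 := Fc b (Bo g) in
  let A6' := coercive b bo /\ X' `<=` idom g `|` g @^-1` [set -oo] in
  [/\ (* a *) [/\ st2 <-> st3, st3 <-> st4, st4 -> st1 & st4 -> st5],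
      (* b *) ((A5 \/ A5') /\ (A6 \/ A6') -> st1 -> st4) /\
              (finite_set [set: Y] -> (A5 \/ A5') /\ (A6 \/ A6')),
      (* c *) X' `<=` idom g `|` g @^-1` [set -oo] -> st5 -> st4 &
      (* d *) (forall x, g x = +oo) \/ (forall x, g x = -oo) ->
              [/\ st1, st2, st3, st4 & st5]].
Proof.
move=> dg st1 st2 st3 st4 st5 A5 A5' A6 A6'.
have st23 : st2 <-> st3.
  split=> [h x /h[y dgxy]|h x /h[y _ dgxy]]; last by exists y.
  by exists y.
have st24 : st2 -> st4.
  move=> h x [/h[y dgxy] gx]; exists y => //.
  exact: (subdiff_ldom b_kernels S_support dgxy gx).
have st42 : st4 -> st2.
  (* (4) says nothing where [g] is [-oo], but such points always have subgradients. *)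
  move=> h x X'x; have [gx|gx] := pselect (-oo < g x).
    by have [y _ dgxy] := h x (conj X'x gx); exists y.
  apply: (subdiff_ninfty b_kernels S_support).
  by apply/eqP; rewrite -leeNy_eq leNgt; apply/negP.
have st41 : st4 -> st1.
  move=> /st42 h; exists (Bo g); split=> [|x /h[y dgxy]].
    exact: (BBo_le B_galois).
  exact: (subdiff_problem B_galois b_kernels S_support dgxy).
have st45 : st4 -> st5.
  move=> h x [X'x [gxpoo gxNoo]].
  have [y yldom dgxy] := h x (conj X'x gxNoo); exists y => //; split=> //.
  exact: (subdiff_udom b_kernels S_support dgxy gxpoo).
split.
- by split=> //; split=> [/st23|/st42/st23].
- split=> [[A55 A66] P x [X'x gx]|finY]; last first.
    split; left; first exact: finite_hausdorff_discrete.
    by move=> x c; exact: finite_hausdorff_precompact.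
  (* Solvability makes [B (Bo g) x = g x]; (A5) or (A5') supplies semicontinuity, (A6) or (A6')
     compactness. *)
  have [y dgxy] : exists y, subdiff bo S g x y.
    apply: (usc_precompact_subdiff b_kernels S_support) => //.
    + exact: (problem_Bo B_galois P X'x).
    + case: A55 => [dY t|[cb Bog]]; first exact: dY.
      exact: (usc_kernel b_kernels S_support).
    + case: A66 => [FcBog|[cob X'g]]; first exact: FcBog.
      case: (X'g x X'x) => [gidom|gNoo].
        exact: (coercive_precompact b_kernels S_support cob gidom).
      by move: gx; rewrite /udom/= gNoo ltxx.
  exists y => //; exact: (subdiff_ldom b_kernels S_support dgxy gx).
(* As [g x] is not [-oo], [x] lies in [idom g], hence in [fdom g], where (5) applies. *)
- move=> X'g h x [X'x gx]; case: (X'g x X'x) => [[gdom _]|gNoo].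
    by have [y [yl _] dgxy] := h x (conj X'x gdom); exists y.
  by move: gx; rewrite /udom/= gNoo ltxx.
(* Both constant cases give (2) directly; the rest follows by (a). *)
- move=> gcst; have s2 : st2.
    move=> x _; case: gcst => gcst; first exact: (subdiff_pinfty b_kernels).
    exact: (subdiff_ninfty b_kernels S_support).
  have s4 := st24 s2; split=> //; [exact: st41|exact/st23|exact: st45].
Qed.
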